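(* Let $A$ be a unital semisimple (complex) Banach algebra with essential socle. Then for every nonzero $a\in A$ there exists $u\in F_1(A)$ such that $u\leq^- a$. Furthermore, for a nonzero $u\in A$, one has $u\in F_1(A)$ if and only if every $v\in A$ with $v\leq^- u$ satisfies $v=u$ or $v=0$. In other words, the elements of $F_1(A)$ are precisely the nonzero minimal elements with respect to $\leq^-$.
   Context: For a unital ring $A$, $A^\bullet$ is the set of idempotents, $\mathrm{ann}_l(a)=\{x\in A: xa=0\}$ and $\mathrm{ann}_r(a)=\{x\in A: ax=0\}$. For $a,b\in A$, $a\leq^- b$ means that there exist $p,q\in A^\bullet$ with $\mathrm{ann}_l(a)=\mathrm{ann}_l(p)$, $\mathrm{ann}_r(a)=\mathrm{ann}_r(q)$, $pa=pb$ and $aq=bq$. Let $A$ be a unital semisimple complex Banach algebra. A minimal idempotent is an element $e$ with $e^2=e\neq0$ and $eAe=\mathbb{C}e$. $F_1(A)$ is the set of rank-one elements: nonzero $u\in A$ that belong to some minimal left ideal of $A$, i.e. $u=ue$ for some minimal idempotent $e$. The socle $\mathrm{Soc}(A)$ is the sum of all minimal left ideals of $A$ (equivalently of all minimal right ideals), and is $\{0\}$ if there are none. A non-zero ideal $I$ is essential if it has non-zero intersection with every non-zero ideal of $A$; for semisimple $A$ this is equivalent to: $aI=0$ with $a\in A$ implies $a=0$. *)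

(* Defs.v *)
From HB Require Import structures.
From mathcomp Require Import all_boot all_order all_algebra.
From mathcomp Require Import complex.
From mathcomp Require Import all_classical all_reals all_analysis.

Set Implicit Arguments.
Unset Strict Implicit.
Unset Printing Implicit Defensive.

Import Order.TTheory GRing.Theory Num.Theory.

Local Open Scope classical_set_scope.
Local Open Scope ring_scope.

(* No HB structure joins algType and completeNormedModType: HB rejects the
   join, because numDomainType is already a join of rings and normed Z-modules.
   The norm is therefore a field of a record over algType, and normed_space puts
   the library's normed module structure on the carrier of the algebra.
   The norm is K-valued; for K = R[i] its values are nonnegative, hence real. *)
Definition normed_space (K : numFieldType) (V : lmodType K)
    (m : Lmodule_isNormed K V) : normedModType K :=
  HB.pack (GRing.Lmodule.sort V) (GRing.Lmodule.class V) m.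

(* The normalization `|1| = 1 is not imposed. *)
Record banachAlgType (K : numFieldType) := BanachAlgebra {
  banach_alg :> algType K;
  banach_norm : Lmodule_isNormed K banach_alg;
  banach_complete : Uniform_isComplete (normed_space banach_norm);
  ler_banach_normM : forall x y : banach_alg,
    Lmodule_isNormed.norm banach_norm (x * y)
      <= Lmodule_isNormed.norm banach_norm x * Lmodule_isNormed.norm banach_norm y
}.

Definition banach_space (K : numFieldType) (A : banachAlgType K) :
    completeNormedModType K :=
  HB.pack (NormedModule.sort (normed_space (banach_norm A)))
    (NormedModule.class (normed_space (banach_norm A))) (banach_complete A).

Section Ideals.
Variable A : nzRingType.
Implicit Types (I J L M : set A) (a b p q u x y : A).

(* When A is a unital algebra over K, closure under scalars is automatic,
   since k *: x = k%:A * x. *)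
Definition left_ideal I : Prop :=
  [/\ I 0, forall x y, I x -> I y -> I (x - y)
    & forall a x, I x -> I (a * x)].

Definition two_sided_ideal I : Prop :=
  left_ideal I /\ forall a x, I x -> I (x * a).

Definition minimal_left_ideal L : Prop :=
  [/\ left_ideal L, L <> [set 0]
    & forall J, left_ideal J -> J `<=` L -> J = [set 0] \/ J = L].

Definition maximal_left_ideal M : Prop :=
  [/\ left_ideal M, M <> setT
    & forall J, left_ideal J -> M `<=` J -> J = M \/ J = setT].

Definition jacobson_radical : set A :=
  \bigcap_(M in [set M | maximal_left_ideal M]) M.

Definition semisimple : Prop := jacobson_radical = [set 0].

Definition socle : set A :=
  [set x | exists2 s : seq A,
     {in s, forall y, exists2 L, minimal_left_ideal L & L y}
     & x = \sum_(y <- s) y].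

Definition essential I : Prop :=
  [/\ two_sided_ideal I, I <> [set 0]
    & forall J, two_sided_ideal J -> J <> [set 0] -> I `&` J <> [set 0]].

Definition rank_one : set A :=
  [set u | u <> 0 /\ exists2 L, minimal_left_ideal L & L u].

Definition idempotents : set A := [set p | p * p = p].

Definition ann_l a : set A := [set x | x * a = 0].

Definition ann_r a : set A := [set x | a * x = 0].

Definition minus_le a b : Prop :=
  exists p q, [/\ idempotents p /\ idempotents q,
    ann_l a = ann_l p, ann_r a = ann_r q, p * a = p * b & a * q = b * q].

End Ideals.

Arguments jacobson_radical A : clear implicits.
Arguments semisimple A : clear implicits.
Arguments socle A : clear implicits.
Arguments rank_one A : clear implicits.
Arguments idempotents A : clear implicits.

Notation "a <=^- b" := (minus_le a b) (at level 70, no associativity) : ring_scope.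

(* Main.v *)
Require Import Defs.
From mathcomp Require Import all_boot all_order all_algebra.
From mathcomp Require Import complex.
From mathcomp Require Import all_classical all_reals all_analysis.

(** The argument is purely ring-theoretic.  If [g] is an outer inverse of [a],
    i.e. [g a g = g], then [a g a <=^- a], witnessed by the idempotents [a g] and
    [g a].  Essentiality of the socle gives a minimal left ideal [L = A e] with
    [a x <> 0] for some [x] in [L]; then [A a x = L] contains [e = b a x], and
    [g = x e b] is an outer inverse of [a] for which [a g a] has rank one.
    Conversely, if [v <=^- u] then [v = p u = u q], so for [u] in a minimal left
    ideal and [v <> 0] one has [u = c v = c u q], hence [u = u q = v]. *)

Import GRing.Theory.

Local Open Scope classical_set_scope.
Local Open Scope ring_scope.

Section LeftIdeals.
Set Implicit Arguments.
Unset Strict Implicit.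
Variable A : nzRingType.
Implicit Types (I J L M : set A) (a b e g p q u v x y : A).

Lemma left_idealD I x y : left_ideal I -> I x -> I y -> I (x + y).
Proof.
case=> I0 IB _ Ix Iy; rewrite -[y]opprK; apply: (IB) => //.
by rewrite -[- y]add0r; apply: IB.
Qed.

Lemma left_idealI I J : left_ideal I -> left_ideal J -> left_ideal (I `&` J).
Proof.
move=> [I0 IB IM] [J0 JB JM]; split; first by split.
- by move=> x y [Ix Jx] [Iy Jy]; split; [apply: IB|apply: JB].
- by move=> a x [Ix Jx]; split; [apply: IM|apply: JM].
Qed.

Lemma left_ideal_mulr I a :
  left_ideal I -> left_ideal [set y | exists2 x, I x & y = x * a].
Proof.
case=> I0 IB IM; split; first by exists 0; rewrite ?mul0r.
- move=> _ _ [x Ix ->] [y Iy ->]; exists (x - y); first exact: IB.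
  by rewrite mulrBl.
- by move=> b _ [x Ix ->]; exists (b * x); [exact: IM|rewrite mulrA].
Qed.

Lemma left_ideal_principal x : left_ideal [set y | exists c, y = c * x].
Proof.
split; first by exists 0; rewrite mul0r.
- by move=> _ _ [c ->] [d ->]; exists (c - d); rewrite mulrBl.
- by move=> b _ [c ->]; exists (b * c); rewrite mulrA.
Qed.

(** The left ideal [A x] lies in [L] and contains [x = 1 * x], so minimality leaves only
    [A x = L]. *)
Lemma minimal_left_ideal_principal L x y :
  minimal_left_ideal L -> L x -> x <> 0 -> L y -> exists c, y = c * x.
Proof.
move=> [[_ _ LM] _ Lmin] Lx x0 Ly.
have /(Lmin _ (left_ideal_principal x)) [x_eq0|JL] :
    [set y | exists c, y = c * x] `<=` L by move=> _ [c ->]; apply: LM.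
  by case: x0; suff : [set 0] x by []; rewrite -x_eq0; exists 1; rewrite mul1r.
by move: Ly; rewrite -JL.
Qed.

(** A nonzero element of a left ideal inside [L a] has the form [w * a] with [w] a generator of [L],
    so it already generates all of [L a]. *)
Lemma minimal_left_ideal_mulr L a x :
  minimal_left_ideal L -> L x -> x * a <> 0 ->
  minimal_left_ideal [set y | exists2 z, L z & y = z * a].
Proof.
move=> Lmin Lx xa0; have [Lid _ _] := Lmin.
split; first exact: left_ideal_mulr.
- by move=> La0; apply: xa0; suff : [set 0] (x * a) by []; rewrite -La0; exists x.
- move=> J Jid JLa; have [J0 _ JM] := Jid.
  have [Jz|] := pselect (J `<=` [set 0]).
    by left; apply/seteqP; split=> // _ ->.
  move=> /existsNP[y /not_implyP[Jy y0]]; right.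
  apply/seteqP; split=> // _ [z Lz ->].
  have [w Lw yE] := JLa _ Jy.
  have w0 : w <> 0 by move=> w0; apply: y0; rewrite yE w0 mul0r.
  have [c ->] := minimal_left_ideal_principal Lmin Lw w0 Lz.
  by rewrite -mulrA -yE; apply: JM.
Qed.

Lemma maximal_left_ideal_comaximal M x :
  maximal_left_ideal M -> ~ M x -> exists m c, M m /\ 1 = m + c * x.
Proof.
move=> [Mid _ Mmax] Mx; have [M0 MB MM] := Mid.
pose J := [set y | exists m c, M m /\ y = m + c * x].
have Jid : left_ideal J.
  split; first by exists 0, 0; rewrite mul0r addr0.
  - move=> _ _ [m [c [Mm ->]]] [n [d [Mn ->]]]; exists (m - n), (c - d).
    by rewrite mulrBl opprD addrACA; split=> //; apply: MB.
  - move=> a _ [m [c [Mm ->]]]; exists (a * m), (a * c).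
    by rewrite mulrDr mulrA; split=> //; apply: MM.
have MJ : M `<=` J by move=> m Mm; exists m, 0; rewrite mul0r addr0.
have [JM|JT] := Mmax _ Jid MJ; last by have : J 1 by rewrite JT.
by case: Mx; rewrite -JM; exists 0, 1; rewrite add0r mul1r.
Qed.

Lemma maximal_left_ideal1 M : maximal_left_ideal M -> ~ M 1.
Proof.
move=> [[_ _ MM] MT _] M1; apply: MT; apply/seteqP; split=> // x _.
by rewrite -[x]mulr1; apply: MM.
Qed.

Lemma semisimple_maximal x :
  semisimple A -> x <> 0 -> exists2 M, maximal_left_ideal M & ~ M x.
Proof.
move=> ss x0; apply: contrapT => noM; apply: x0.
suff : jacobson_radical A x by rewrite ss.
by move=> M Mmax; apply: contrapT => Mx; apply: noM; exists M.
Qed.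

(** If a maximal left ideal [M] misses [x], write [1 = m + c * x] and multiply by [c * x] on the
    left: its square vanishes, so [c * x = c * x * m] is in [M], and then so is [1]. *)
Lemma semisimple_nil_left_ideal I x : semisimple A -> left_ideal I ->
  (forall y, I y -> y * y = 0) -> I x -> x = 0.
Proof.
move=> ss [_ _ IM] Inil Ix; apply: contrapT => x0.
have [M Mmax Mx] := semisimple_maximal ss x0.
have [m [c [Mm E]]] := maximal_left_ideal_comaximal Mmax Mx.
have [Mid _ _] := Mmax; have [_ _ MM] := Mid.
apply: (maximal_left_ideal1 Mmax); rewrite E; apply: left_idealD => //.
have -> : c * x = c * x * m.
  by rewrite -[LHS]mulr1 E mulrDr (Inil (c * x)) ?addr0 //; apply: IM.
exact: MM.
Qed.

(* Splitting [1 = m + e] along [A = M + L], for a maximal left ideal [M] not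
   containing [L], makes [e] a right unit of [L] because [L * m] lies in
   [L `&` M = 0]. *)
Lemma minimal_left_ideal_right_unit L :
  semisimple A -> minimal_left_ideal L ->
  exists2 e, L e & forall y, L y -> y * e = y.
Proof.
move=> ss [Lid L0 Lmin]; have [Lz LB LM] := Lid.
have [x Lx x0] : exists2 x, L x & x <> 0.
  apply: contrapT => nox; apply: L0; apply/seteqP; split=> [x Lx|_ ->//].
  by apply: contrapT => x0; apply: nox; exists x.
have [M Mmax Mx] := semisimple_maximal ss x0.
have [m [c [Mm E]]] := maximal_left_ideal_comaximal Mmax Mx.
have [Mid _ _] := Mmax; have [_ _ MM] := Mid.
have LM0 : L `&` M = [set 0].
  have [//|LME] := Lmin _ (left_idealI Lid Mid) (@subIsetl _ L M).
  by case: Mx; move: Lx; rewrite -LME => -[].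
exists (c * x); first exact: LM.
move=> y Ly; have Eym : y * m = y - y * (c * x).
  by rewrite -[X in X - _]mulr1 E mulrDr addrK.
have : (L `&` M) (y * m).
  by split; [rewrite Eym; apply: LB => //; apply: (LM); apply: LM|apply: MM].
by rewrite LM0 Eym => /eqP; rewrite subr_eq0 => /eqP.
Qed.

(** The left annihilator [J] of the socle is two-sided, and every element of [J] that lies in the
    socle squares to zero. Hence [J] meets the socle trivially, and essentiality gives [J = 0]. *)
Lemma essential_socle_annihilator a : semisimple A -> essential (socle A) ->
  (forall s, socle A s -> a * s = 0) -> a = 0.
Proof.
move=> ss [[Sid _] _ Sess] aS; apply: contrapT => a0.
have [_ _ SM] := Sid.
pose J := [set b | forall s, socle A s -> b * s = 0].
have Jid : left_ideal J.
  split; first by move=> s _; rewrite mul0r.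
  - by move=> x y Jx Jy s Ss; rewrite mulrBl Jx ?Jy ?subr0.
  - by move=> b x Jx s Ss; rewrite -mulrA Jx ?mulr0.
have J2 : two_sided_ideal J.
  by split=> // b x Jx s Ss; rewrite -mulrA Jx //; apply: SM.
have SJid := left_idealI Sid Jid.
apply: (Sess J J2) => [J0|].
  by apply: a0; suff : [set 0] a by []; rewrite -J0.
apply/seteqP; split=> [x|_ ->]; last by case: SJid.
by apply: semisimple_nil_left_ideal => // y [Sy Jy]; apply: Jy.
Qed.

Lemma minimal_left_ideal_not_annihilated a :
  semisimple A -> essential (socle A) -> a <> 0 ->
  exists L x, [/\ minimal_left_ideal L, L x & a * x <> 0].
Proof.
move=> ss Sess a0; apply: contrapT => noL; apply: a0.
apply: essential_socle_annihilator => // _ [s sL ->].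
rewrite mulr_sumr big_seq big1 // => x /sL[L Lmin Lx].
by apply: contrapT => ax0; apply: noL; exists L, x.
Qed.

Lemma minus_le_outer_inverse a g : g * a * g = g -> (a * g * a <=^- a).
Proof.
move=> gag; have agag : a * g * (a * g) = a * g by rewrite -mulrA (mulrA g) gag.
have gaga : g * a * (g * a) = g * a by rewrite mulrA gag.
exists (a * g), (g * a); split; first by split.
(* Multiplying [x * (a * g * a) = 0] by [g] on the right gives [x * (a * g) = 0], as [a * g] is
   idempotent; the right annihilators are symmetric. *)
- apply/seteqP; split=> x; rewrite /ann_l /= => E; last by rewrite mulrA E mul0r.
  by rewrite -agag [a * g * _]mulrA mulrA E mul0r.
- apply/seteqP; split=> x; rewrite /ann_r /= => E.
    by rewrite -gaga -!mulrA; rewrite -!mulrA in E; rewrite E mulr0.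
  by rewrite -!mulrA; rewrite -!mulrA in E; rewrite E mulr0.
- by rewrite mulrA agag.
- by rewrite -(mulrA a) -mulrA gaga.
Qed.

Lemma exists_rank_one_minus_le a : semisimple A -> essential (socle A) ->
  a <> 0 -> exists2 u, rank_one A u & u <=^- a.
Proof.
move=> ss Sess a0.
have [L [x [Lmin Lx ax0]]] := minimal_left_ideal_not_annihilated ss Sess a0.
have [e Le eR] := minimal_left_ideal_right_unit ss Lmin.
have [[_ _ LM] _ _] := Lmin.
have [b eE] := minimal_left_ideal_principal Lmin (LM a x Lx) ax0 Le.
pose g := x * (e * b).
(* Since [b * (a * x) = e], this product is [x * (e * e)], and [e] is a right unit of [L]. *)
have gax : g * a * x = x by rewrite /g -!mulrA -eE !eR.
have gag : g * a * g = g by rewrite {2}/g mulrA gax.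
exists (a * g * a); last exact: minus_le_outer_inverse.
have u0 : a * g * a <> 0.
  by move=> u0; apply: ax0; rewrite -gax -(mulrA g) mulrA mulrA u0 mul0r.
have uE : a * g * a = a * x * (e * b * a) by rewrite /g !mulrA.
split=> //; exists [set y | exists2 z, L z & y = z * (e * b * a)].
  by apply: minimal_left_ideal_mulr (LM a x Lx) _ => //; rewrite -uE.
by exists (a * x); first exact: LM.
Qed.

(** As [1 - p] kills [p] from the left, it kills [v] too, so [v = p * v = p * u]; dually for [q]. *)
Lemma minus_leE v u : v <=^- u ->
  exists p q, [/\ q * q = q, v = p * u & v = u * q].
Proof.
move=> [p [q [[pp qq] annl annr pE qE]]]; exists p, q; split=> //.
- have : ann_l v (1 - p) by rewrite annl /ann_l /= mulrBl mul1r pp subrr.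
  by rewrite /ann_l /= mulrBl mul1r pE => /eqP; rewrite subr_eq0 => /eqP.
- have : ann_r v (1 - q) by rewrite annr /ann_r /= mulrBr mulr1 qq subrr.
  by rewrite /ann_r /= mulrBr mulr1 qE => /eqP; rewrite subr_eq0 => /eqP.
Qed.

Lemma rank_one_minus_le u v : rank_one A u -> v <=^- u -> v = u \/ v = 0.
Proof.
move=> [_ [L Lmin Lu]] /minus_leE[p [q [qq vp vq]]].
have [v0|v0] := pselect (v = 0); [by right|left].
have [[_ _ LM] _ _] := Lmin.
have Lv : L v by rewrite vp; apply: LM.
have [c uE] := minimal_left_ideal_principal Lmin Lv v0 Lu.
by rewrite vq {1}uE vq -!mulrA qq -vq -uE.
Qed.

End LeftIdeals.

Theorem proposition2p15 (R : realType) (A : banachAlgType R[i])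
    (A_semisimple : semisimple A) (socle_essential : essential (socle A)) :
  (forall a : A, a <> 0 -> exists2 u : A, rank_one A u & u <=^- a) /\
  (forall u : A, u <> 0 ->
     (rank_one A u <-> (forall v : A, v <=^- u -> v = u \/ v = 0))).
Proof.
have ex_le (a : A) : a <> 0 -> exists2 u : A, rank_one A u & u <=^- a.
  exact: exists_rank_one_minus_le.
split=> // u u0; split=> [u1 v|umin]; first exact: rank_one_minus_le.
(* A rank-one [w] below [u] is nonzero, so minimality of [u] forces [w = u]. *)
have [w w1 wu] := ex_le u u0.
by case: (umin w wu) w1 => -> // -[].
Qed.
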